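(* The class $\mathcal D$ of all flat Mittag-Leffler abelian groups is not precovering. Thus $\mathcal D$ cannot induce a cofibrantly generated model category structure on $\mathfrak{Qco}(\mathrm{Spec}(\mathbb Z))\cong\mathrm{Mod}\text{-}\mathbb Z$ compatible with its abelian structure.
   Context: $\mathrm{Mod}\text{-}\mathbb Z$ is the category of abelian groups, and $\mathfrak{Qco}(\mathrm{Spec}(\mathbb Z))$ is the category of quasi-coherent sheaves on the affine scheme $\mathrm{Spec}(\mathbb Z)$, which is equivalent to it. An abelian group $M$ is Mittag-Leffler if the canonical map $M\otimes_{\mathbb Z}\prod_{i\in I}M_i\to\prod_{i\in I}M\otimes_{\mathbb Z}M_i$ is injective for every family $(M_i)_{i\in I}$ of abelian groups. For a class $\mathcal F$ of objects in a Grothendieck category $\mathcal A$, an $\mathcal F$-precover of an object $M$ is a morphism $\varphi:F\to M$ with $F\in\mathcal F$ such that $\mathrm{Hom}_{\mathcal A}(F',F)\to\mathrm{Hom}_{\mathcal A}(F',M)$ is surjective for every $F'\in\mathcal F$; the class $\mathcal F$ is precovering if every object of $\mathcal A$ has an $\mathcal F$-precover. Here precovering is meant in $\mathrm{Mod}\text{-}\mathbb Z$. A model structure on an abelian category is compatible with the abelian structure (in the sense of Hovey) if the (trivial) cofibrations are exactly the monomorphisms with (trivially) cofibrant cokernel and the (trivial) fibrations are exactly the epimorphisms with (trivially) fibrant kernel. The result is proved in ZFC. *)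

(* Defs.v *)
From HB Require Import structures.
From mathcomp Require Import all_boot all_order all_algebra.
From mathcomp Require Import generic_quotient ring_quotient.
From mathcomp Require Import boolp wochoice.
From mathcomp Require Import freeg.

Set Implicit Arguments.
Unset Strict Implicit.
Unset Printing Implicit Defensive.

Import GRing.Theory.
Local Open Scope ring_scope.
Local Open Scope quotient_scope.

(* The universe of the carriers of abelian groups: a type is small (a "set")
   when it lives there.  Naming it keeps "every family" and "a set of maps"
   from being read in a universe that is strictly smaller or larger. *)
Definition small := Type@{mathcomp.boot.nmodule.Algebra.Zmodule.axioms_.u0}.

Section Tensor.
Variables M N : zmodType.

Inductive tensor_rel : {freeg (M * N)%type} -> Prop :=
| tensor_rel0 : tensor_rel 0
| tensor_relB x y : tensor_rel x -> tensor_rel y -> tensor_rel (x - y)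
| tensor_relDl m m' n :
    tensor_rel (<< (m + m', n) >> - (<< (m, n) >> + << (m', n) >>))
| tensor_relDr m n n' :
    tensor_rel (<< (m, n + n') >> - (<< (m, n) >> + << (m, n') >>)).

Definition tensor_null : {pred {freeg (M * N)%type}} :=
  fun x => `[< tensor_rel x >].

Lemma tensor_null_zmod_closed : zmod_closed tensor_null.
Proof.
split; first exact/asboolP/tensor_rel0.
by move=> x y /asboolP hx /asboolP hy; exact/asboolP/tensor_relB.
Qed.

HB.instance Definition _ :=
  GRing.isZmodClosed.Build {freeg (M * N)%type} tensor_null
    tensor_null_zmod_closed.

Definition tensor : zmodType := Quotient.quot tensor_null.

Definition tensor_pi (x : {freeg (M * N)%type}) : tensor :=
  \pi_(Quotient.quot tensor_null) x.

Lemma tensor_pi_zmod_morphism : zmod_morphism tensor_pi.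
Proof. by move=> x y; rewrite /tensor_pi pi_addr pi_oppr. Qed.

HB.instance Definition _ :=
  GRing.isZmodMorphism.Build {freeg (M * N)%type} tensor tensor_pi
    tensor_pi_zmod_morphism.

Lemma tensor_pi_eq x y : tensor_pi x = tensor_pi y <-> tensor_rel (x - y).
Proof.
split=> [/eqP|xy]; last apply/eqP.
  by rewrite -Quotient.idealrBE => /asboolP.
by rewrite -Quotient.idealrBE; apply/asboolP.
Qed.

Definition tens (m : M) (n : N) : tensor := tensor_pi << (m, n) >>.

Definition biadditive (P : zmodType) (f : M -> N -> P) :=
  (forall m m' n, f (m + m') n = f m n + f m' n) /\
  (forall m n n', f m (n + n') = f m n + f m n').

(* [fglift] only targets modules; [zmodule P] is P seen as a Z-module. *)
Definition pair_lift (P : zmodType) (f : M -> N -> P)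
    (x : {freeg (M * N)%type}) : P :=
  fglift (fun p => f p.1 p.2 : zmodule P) x.

Lemma pair_lift_zmod_morphism (P : zmodType) (f : M -> N -> P) :
  zmod_morphism (pair_lift f).
Proof.
exact: (@freeg.lift_is_additive _ _ (zmodule P) (fun p => f p.1 p.2)).
Qed.

HB.instance Definition _ (P : zmodType) (f : M -> N -> P) :=
  GRing.isZmodMorphism.Build {freeg (M * N)%type} P (@pair_lift P f)
    (@pair_lift_zmod_morphism P f).

Lemma pair_liftU (P : zmodType) (f : M -> N -> P) m n : pair_lift f << (m, n) >> = f m n.
Proof. by rewrite /pair_lift liftU scale1r. Qed.

(* The homomorphism induced by a biadditive f, see [tensor_lift_tens],
   [tensor_lift_zmod_morphism] and [tensor_ext]. *)
Definition tensor_lift (P : zmodType) (f : M -> N -> P) (x : tensor) : P :=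
  pair_lift f (repr (x : Quotient.quot tensor_null)).

Lemma tens_biadditive : biadditive tens.
Proof.
by split=> *; rewrite /tens -raddfD; apply/tensor_pi_eq; constructor.
Qed.

Lemma tensor_lift_pi (P : zmodType) (f : M -> N -> P) x :
  biadditive f -> tensor_lift f (tensor_pi x) = pair_lift f x.
Proof.
case=> fDl fDr; rewrite /tensor_lift; set y := repr _.
have /tensor_pi_eq yx : tensor_pi y = tensor_pi x by exact: reprK.
suff L0 z : tensor_rel z -> pair_lift f z = 0.
  by apply/eqP; rewrite -subr_eq0 -raddfB; apply/eqP/L0.
elim=> [|u v _ Lu _ Lv|m m' n|m n n'].
- exact: raddf0.
- by rewrite raddfB /= Lu Lv subr0.
- by rewrite raddfB raddfD /= !pair_liftU fDl subrr.
- by rewrite raddfB raddfD /= !pair_liftU fDr subrr.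
Qed.

Lemma tensor_lift_tens (P : zmodType) (f : M -> N -> P) m n :
  biadditive f -> tensor_lift f (tens m n) = f m n.
Proof. by move=> fD; rewrite tensor_lift_pi // pair_liftU. Qed.

Lemma tensor_piP (x : tensor) : exists y, x = tensor_pi y.
Proof.
by exists (repr (x : Quotient.quot tensor_null)); rewrite /tensor_pi reprK.
Qed.

Lemma tensor_lift_zmod_morphism (P : zmodType) (f : M -> N -> P) :
  biadditive f -> zmod_morphism (tensor_lift f).
Proof.
move=> fD x y; have [[u ->] [v ->]] := (tensor_piP x, tensor_piP y).
by rewrite -raddfB !tensor_lift_pi // raddfB.
Qed.

Lemma tensor_ext (P : zmodType) (f g : {additive tensor -> P}) :
  (forall m n, f (tens m n) = g (tens m n)) -> f =1 g.
Proof.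
move=> fg x; have [u ->] := tensor_piP x; rewrite -(freeg_sumE u) !raddf_sum.
apply: eq_bigr => -[m n] _; rewrite -[coeff _ _]intz -freegU_mulz.
by rewrite !raddfMz; congr (_ *~ _); apply: fg.
Qed.

End Tensor.

Definition tensor_map (M A B : zmodType) (f : A -> B) : tensor M A -> tensor M B :=
  tensor_lift (fun m a => tens m (f a)).

Lemma tensor_map_tens (M A B : zmodType) (f : {additive A -> B}) m a :
  @tensor_map M A B f (tens m a) = tens m (f a).
Proof.
have [tDl tDr] := @tens_biadditive M B.
by rewrite /tensor_map tensor_lift_tens //; split=> *; rewrite ?raddfD ?tDl ?tDr.
Qed.

Section Product.
Variables (I : small) (M : I -> zmodType).

Definition product : Type := forall i, M i.

HB.instance Definition _ := Choice.copy product (forall i, M i).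

Implicit Types x y z : product.

Definition product_zero : product := fun=> 0.
Definition product_opp x : product := fun i => - x i.
Definition product_add x y : product := fun i => x i + y i.

Lemma product_addA : associative product_add.
Proof. by move=> x y z; apply: functional_extensionality_dep => i; apply: addrA. Qed.

Lemma product_addC : commutative product_add.
Proof. by move=> x y; apply: functional_extensionality_dep => i; apply: addrC. Qed.

Lemma product_add0 : left_id product_zero product_add.
Proof. by move=> x; apply: functional_extensionality_dep => i; apply: add0r. Qed.

Lemma product_addN : left_inverse product_zero product_opp product_add.
Proof. by move=> x; apply: functional_extensionality_dep => i; apply: addNr. Qed.

HB.instance Definition _ := GRing.isZmodule.Build product
  product_addA product_addC product_add0 product_addN.

End Product.

(* The functor M (x) - is right exact, so it is exact as soon as it preserves
   monomorphisms. *)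
Definition flat (M : zmodType) :=
  forall (A B : zmodType) (f : {additive A -> B}),
    injective f -> injective (@tensor_map M A B f).

Definition tensor_product_map (M : zmodType) (I : small) (N : I -> zmodType) :
    tensor M (product N) -> product (fun i => tensor M (N i)) :=
  tensor_lift (fun m (x : product N) =>
    (fun i => tens m (x i)) : product (fun i => tensor M (N i))).

Lemma tensor_product_map_tens (M : zmodType) (I : small) (N : I -> zmodType) m x i :
  @tensor_product_map M I N (tens m x) i = tens m (x i).
Proof.
rewrite /tensor_product_map tensor_lift_tens //.
by split=> *; apply: functional_extensionality_dep => j;
  have [tDl tDr] := @tens_biadditive M (N j); [apply: tDl | apply: tDr].
Qed.

Definition mittag_leffler (M : zmodType) :=
  forall (I : small) (N : I -> zmodType), injective (@tensor_product_map M I N).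

Definition flat_mittag_leffler (M : zmodType) := flat M /\ mittag_leffler M.

Record category := Category {
  ob :> Type;
  hom : ob -> ob -> Type;
  idm : forall X, hom X X;
  comp : forall X Y Z, hom Y Z -> hom X Y -> hom X Z;
  comp1m : forall X Y (f : hom X Y), comp (idm Y) f = f;
  compm1 : forall X Y (f : hom X Y), comp f (idm X) = f;
  compA : forall X Y Z T (f : hom Z T) (g : hom Y Z) (h : hom X Y),
    comp f (comp g h) = comp (comp f g) h
}.

Arguments hom {c} X Y.
Arguments idm {c} X.
Arguments comp {c X Y Z} f g.

Notation "f '\oc' g" := (comp f g) (at level 50, left associativity).

Lemma additive_eq (U V : zmodType) (f g : {additive U -> V}) : f =1 g -> f = g.
Proof.
case: f g => [f cf] [g cg] /= fg.
have {}fg : f = g by apply: functional_extensionality_dep.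
case: g / fg in cg *; case: cf cg => [[p]] [[q]].
by have -> : p = q by exact: Prop_irrelevance.
Qed.

Definition Ab : category.
Proof.
refine {| ob := zmodType; hom := fun U V => {additive U -> V};
          idm := fun U => [the {additive U -> U} of idfun];
          comp := fun U V W f g => [the {additive U -> W} of f \o g] |};
  by move=> *; apply: additive_eq.
Defined.

Record functor (C D : category) := Functor {
  fob :> C -> D;
  fmap : forall X Y, hom X Y -> hom (fob X) (fob Y);
  fmap1 : forall X, fmap (idm X) = idm (fob X);
  fmapM : forall X Y Z (f : hom Y Z) (g : hom X Y),
    fmap (f \oc g) = fmap f \oc fmap g
}.

Section Category.
Variable C : category.

Definition is_iso (X Y : C) (f : hom X Y) :=
  exists g : hom Y X, g \oc f = idm X /\ f \oc g = idm Y.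

Definition isomorphic (X Y : C) := exists f : hom X Y, is_iso f.

Definition monic (X Y : C) (f : hom X Y) :=
  forall T (g h : hom T X), f \oc g = f \oc h -> g = h.

Definition epic (X Y : C) (f : hom X Y) :=
  forall T (g h : hom Y T), g \oc f = h \oc f -> g = h.

Definition initial (Z : C) := forall X, exists! f : hom Z X, True.
Definition terminal (Z : C) := forall X, exists! f : hom X Z, True.
Definition zero_object (Z : C) := initial Z /\ terminal Z.

Definition zero_map (X Y : C) (f : hom X Y) :=
  exists Z (g : hom Z Y) (h : hom X Z), zero_object Z /\ f = g \oc h.

Definition is_kernel (X Y K : C) (f : hom X Y) (k : hom K X) :=
  zero_map (f \oc k) /\
  forall T (g : hom T X), zero_map (f \oc g) -> exists! h, k \oc h = g.

Definition is_cokernel (X Y Q : C) (f : hom X Y) (q : hom Y Q) :=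
  zero_map (q \oc f) /\
  forall T (g : hom Y T), zero_map (g \oc f) -> exists! h, h \oc q = g.

(* [A <-u- X -f-> Y] completed by [A -g-> B <-v- Y] *)
Definition is_pushout (X Y A B : C) (f : hom X Y) (u : hom X A) (v : hom Y B)
    (g : hom A B) :=
  g \oc u = v \oc f /\
  forall T (a : hom A T) (b : hom Y T), a \oc u = b \oc f ->
    exists! h, h \oc g = a /\ h \oc v = b.

Definition is_precover (F : C -> Prop) (X M : C) (phi : hom X M) :=
  F X /\
  forall X', F X' -> forall f : hom X' M, exists g : hom X' X, phi \oc g = f.

Definition precovering (F : C -> Prop) :=
  forall M, exists X (phi : hom X M), is_precover F phi.

Definition mclass := forall X Y : C, hom X Y -> Prop.

(* A set, as opposed to a class, of morphisms *)
Record mset := Mset {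
  mset_idx : small;
  mset_src : mset_idx -> C;
  mset_tgt : mset_idx -> C;
  mset_map : forall k, hom (mset_src k) (mset_tgt k)
}.

Inductive mset_in (S : mset) : mclass :=
| MsetIn (k : mset_idx S) : mset_in S (mset_map k).

Definition lifting (A B X Y : C) (i : hom A B) (p : hom X Y) :=
  forall (u : hom A X) (v : hom B Y), p \oc u = v \oc i ->
    exists h : hom B X, h \oc i = u /\ p \oc h = v.

Definition right_lifting (S : mclass) : mclass :=
  fun X Y p => forall A B (i : hom A B), S A B i -> lifting i p.

Definition is_retract (A B X Y : C) (f : hom A B) (g : hom X Y) :=
  exists (s : hom A X) (r : hom X A) (s' : hom B Y) (r' : hom Y B),
    r \oc s = idm A /\ r' \oc s' = idm B /\
    g \oc s = s' \oc f /\ f \oc r = r' \oc g.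

Definition mand (S T : mclass) : mclass := fun X Y f => S X Y f /\ T X Y f.

End Category.

Arguments mclass C : clear implicits.
Arguments mset C : clear implicits.

Record is_equivalence (C D : category) (G : functor C D) := IsEquivalence {
  fully_faithful : forall X Y : C, bijective (@fmap C D G X Y);
  essentially_surjective : forall Y : D, exists X : C, isomorphic (G X) Y
}.

(* Ordinals are represented by well-ordered small types. *)
Section Ordinal.
Variables (L : small) (le : rel L).

Definition slt : rel L := fun a b => le a b && ~~ le b a.

Lemma slt_le a b : slt a b -> le a b. Proof. by case/andP. Qed.

Definition successor a b := slt a b /\ forall c, slt a c -> le b c.

Definition limit_point b :=
  (exists a, slt a b) /\ forall a, slt a b -> exists c, slt a c /\ slt c b.

Definition least o := forall a, le o a.

(* L is a nonzero limit ordinal in which every subset of cardinality at most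
   that of K has a supremum, that is, a strict upper bound. *)
Definition filtered (K : small) :=
  (exists a : L, True) /\ (forall a, exists b, slt a b) /\
  forall f : K -> L, exists b, forall k, slt (f k) b.

Variable C : category.

Record diagram := Diagram {
  dob :> L -> C;
  dmap : forall a b, le a b -> hom (dob a) (dob b);
  dmap1 : forall a (p : le a a), dmap p = idm (dob a);
  dmapM : forall a b c (p : le a b) (q : le b c) (r : le a c),
    dmap q \oc dmap p = dmap r
}.

(* f exhibits Y as the colimit of the restriction of X to P. *)
Definition is_colimit (P : pred L) (X : diagram) (Y : C)
    (f : forall a, P a -> hom (X a) Y) :=
  (forall a b (pa : P a) (pb : P b) (p : le a b), f b pb \oc dmap X p = f a pa) /\
  forall T (g : forall a, P a -> hom (X a) T),
    (forall a b (pa : P a) (pb : P b) (p : le a b), g b pb \oc dmap X p = g a pa) ->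
    exists! h, forall a (pa : P a), h \oc f a pa = g a pa.

Definition is_full_colimit (X : diagram) (Y : C) (f : forall a, hom (X a) Y) :=
  @is_colimit predT X Y (fun a _ => f a).

(* A colimit-preserving functor on the ordinal L whose maps from each stage to
   the next one belong to S *)
Definition is_sequence (S : mclass C) (X : diagram) :=
  (forall b, limit_point b ->
     @is_colimit (fun a => slt a b) X (X b) (fun a p => dmap X (slt_le p))) /\
  (forall a b (p : le a b), successor a b -> S _ _ (dmap X p)).

End Ordinal.

(* A is small relative to S: hom A - preserves the colimits of the sequences in
   S whose length is K-filtered, for some cardinal K. *)
Definition small_relative (C : category) (A : C) (S : mclass C) :=
  exists K : small, forall (L : small) (le : rel L),
    well_order le -> filtered le K ->
    forall X : diagram le C, is_sequence S X ->
    forall (Y : C) (f : forall a, hom (X a) Y), is_full_colimit f ->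
      (forall g : hom A Y, exists a (h : hom A (X a)), f a \oc h = g) /\
      (forall a (g h : hom A (X a)), f a \oc g = f a \oc h ->
         exists b (p : le a b), dmap X p \oc g = dmap X p \oc h).

Inductive pushout_of (C : category) (S : mclass C) : mclass C :=
| PushoutOf (X Y A B : C) (f : hom X Y) (u : hom X A) (v : hom Y B) (g : hom A B) :
    S X Y f -> is_pushout f u v g -> pushout_of S g.

(* Relative S-cell complexes: transfinite compositions of pushouts of elements
   of S *)
Inductive cell (C : category) (S : mclass C) : mclass C :=
| Cell (L : small) (le : rel L) (o : L) (X : diagram le C) (Y : C)
    (f : forall a, hom (X a) Y) :
    well_order le -> least le o -> is_sequence (pushout_of S) X ->
    is_full_colimit f -> cell S (f o).

Record model_data (C : category) := ModelData {
  weq : mclass C;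
  cof : mclass C;
  fib : mclass C
}.

Section Model.
Variables (C : category) (m : model_data C).

Definition trivial_cof := mand (cof m) (weq m).
Definition trivial_fib := mand (fib m) (weq m).

Definition two_out_of_three (W : mclass C) :=
  forall X Y Z (g : hom Y Z) (f : hom X Y),
    [/\ W _ _ f -> W _ _ g -> W _ _ (g \oc f),
        W _ _ f -> W _ _ (g \oc f) -> W _ _ g
      & W _ _ g -> W _ _ (g \oc f) -> W _ _ f].

Definition retract_closed (S : mclass C) :=
  forall A B X Y (f : hom A B) (g : hom X Y),
    is_retract f g -> S _ _ g -> S _ _ f.

Definition lifts_against (S T : mclass C) :=
  forall A B X Y (i : hom A B) (p : hom X Y),
    S _ _ i -> T _ _ p -> lifting i p.

Definition factors_through (S T : mclass C) :=
  forall X Y (f : hom X Y), exists Z (i : hom X Z) (p : hom Z Y),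
    [/\ S _ _ i, T _ _ p & p \oc i = f].

Record is_model_structure : Prop := IsModelStructure {
  weq_two_out_of_three : two_out_of_three (weq m);
  weq_retract : retract_closed (weq m);
  cof_retract : retract_closed (cof m);
  fib_retract : retract_closed (fib m);
  cof_lifts : lifts_against (cof m) trivial_fib;
  trivial_cof_lifts : lifts_against trivial_cof (fib m);
  cof_factors : factors_through (cof m) trivial_fib;
  trivial_cof_factors : factors_through trivial_cof (fib m)
}.

Definition cofibrantly_generated :=
  exists I J : mset C,
    [/\ forall k : mset_idx I, small_relative (mset_src k) (cell (mset_in I)),
        forall k : mset_idx J, small_relative (mset_src k) (cell (mset_in J)),
        forall X Y (p : hom X Y), fib m p <-> right_lifting (mset_in J) p
      & forall X Y (p : hom X Y), trivial_fib p <-> right_lifting (mset_in I) p].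

Definition cofibrant (X : C) :=
  exists Z (f : hom Z X), initial Z /\ cof m f.

Definition trivially_cofibrant (X : C) :=
  exists Z (f : hom Z X), initial Z /\ trivial_cof f.

Definition fibrant (X : C) :=
  exists Z (f : hom X Z), terminal Z /\ fib m f.

Definition trivially_fibrant (X : C) :=
  exists Z (f : hom X Z), terminal Z /\ trivial_fib f.

Definition monic_with_cokernel (P : C -> Prop) : mclass C := fun X Y f =>
  monic f /\ exists Q (q : hom Y Q), is_cokernel f q /\ P Q.

Definition epic_with_kernel (P : C -> Prop) : mclass C := fun X Y f =>
  epic f /\ exists K (k : hom K X), is_kernel f k /\ P K.

Definition abelian_compatible :=
  forall X Y (f : hom X Y),
    [/\ cof m f <-> monic_with_cokernel cofibrant f,
        trivial_cof f <-> monic_with_cokernel trivially_cofibrant f,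
        fib m f <-> epic_with_kernel fibrant f
      & trivial_fib f <-> epic_with_kernel trivially_fibrant f].

(* The class D induces m when D is the left-hand class of one of the two
   cotorsion pairs (C, F n W), (C n W, F) that correspond to a compatible m
   with cofibrant objects C, fibrant objects F and trivial objects W. *)
Definition induced_by (D : C -> Prop) :=
  (forall X, D X <-> cofibrant X) \/ (forall X, D X <-> trivially_cofibrant X).

End Model.

(* Main.v *)
Require Import Defs.
From mathcomp Require Import all_boot.
From HB Require Import structures.
From mathcomp Require Import order ssralg ssrnum ssrint rat intdiv zmodp ring.
From mathcomp Require Import boolp freeg.

Set Implicit Arguments.
Unset Strict Implicit.
Unset Printing Implicit Defensive.

Import Order.TTheory GRing.Theory Num.Theory.
Local Open Scope ring_scope.

(** Let [phi : B -> Q] be a homomorphism from a flat Mittag-Leffler group [B].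
    It is not a precover, because of a flat Mittag-Leffler group [E] that has
    more homomorphisms to [Q] than to [B].

    Call [M] locally projective when every [x] in [M] is a finite sum
    [x = sum_i phi_i(x) p_i] with [phi_i] in [Hom(M, Z)] and [p_i] in [M]; then
    finitely many elements admit a common expression of this kind, a tensor [t]
    in [M (x) A] vanishes as soon as all its contractions [(phi (x) 1)(t)] in
    [A] do, and so [M] is flat and Mittag-Leffler
    ([locally_projective_flat_mittag_leffler]).  Pure subgroups of powers of Z
    are locally projective ([pure_in_power_locally_projective]).

    On the side of [B], an element [b] divisible by all powers of 2 is zero
    ([flat_mittag_leffler_reduced]): [b (x) (1, 1, ...)] is zero in every
    [B (x) Z/2^n], hence in [B (x) prod_n Z/2^n] by the Mittag-Leffler
    property, hence [b (x) 1 = 0] in [B (x) Z] by flatness, as Z embeds in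
    [prod_n Z/2^n].

    The group [E] comes from a tree with set of nodes [I] and set of branches
    [X].  It is the pure subgroup of [Z^I] generated by the functions of finite
    support and, for each branch [x], by a function whose value at the node of
    level [n] of [x] is [2^n] and which is zero elsewhere.  Every function from
    [X] to {0, 1} gives a homomorphism from [E] to [Q], and distinct functions
    give distinct homomorphisms.  On the other hand, the quotient of [E] by the
    functions of finite support is 2-divisible, so a homomorphism from [E] to
    [B] is determined by its values on the basis [tree_delta i] of these
    functions, that is, by a map from [I] to [B].  The tree is built by
    recursion so that its branches are themselves the maps from [I] to [B]: if
    all homomorphisms from [E] to [Q] factored through [phi], there would be an
    injection of the power set of [X] into [X]
    ([locally_projective_nonfactoring]).

    In a model structure, factoring [0 -> M] gives a precover of [M] by a
    cofibrant object, as well as one by a trivially cofibrant object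
    ([model_precover]); along an equivalence with abelian groups, such
    precovers cannot exist when one of these classes is that of the flat
    Mittag-Leffler groups ([equivalence_no_precover]). *)

(** * Locally projective abelian groups *)

Definition additive_of (U V : zmodType) (f : U -> V) (fB : zmod_morphism f) :
    {additive U -> V} :=
  HB.pack f (GRing.isZmodMorphism.Build U V f fB).

Lemma additiveD_zmod_morphism (U V : zmodType) (f : U -> V) :
  {morph f : x y / x + y} -> zmod_morphism f.
Proof. by move=> fD x y; rewrite -{2}(subrK y x) (fD (x - y)) addrK. Qed.

Lemma zmod_morphism_inj (U V : zmodType) (f : U -> V) :
  zmod_morphism f -> (forall x, f x = 0 -> x = 0) -> injective f.
Proof.
move=> fB f0 x y fxy; apply/eqP; rewrite -subr_eq0; apply/eqP/f0.
by rewrite fB fxy subrr.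
Qed.

(** The pairs [(phi, p)] of [s] play the role of a dual basis for the single
    element [x]; see [locally_projective_seq] for finitely many elements. *)
Definition locally_projective (M : zmodType) :=
  forall x : M, exists s : seq ({additive M -> int} * M),
    x = \sum_(b <- s) b.2 *~ b.1 x.

Lemma locally_projective_seq (M : zmodType) (xs : seq M) :
  locally_projective M ->
  exists s : seq ({additive M -> int} * M),
    forall x, x \in xs -> x = \sum_(b <- s) b.2 *~ b.1 x.
Proof.
move=> lpM; elim: xs => [|y xs [s sP]]; first by exists [::].
pose pi x := \sum_(b <- s) b.2 *~ b.1 x.
have piB : zmod_morphism pi.
  by move=> u v; rewrite -sumrB; apply: eq_bigr => b _; rewrite raddfB mulrzBr.
have [t tP] := lpM (y - pi y).
have cB (f : {additive M -> int}) : zmod_morphism (fun x => f (x - pi x)).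
  move=> u v; rewrite piB -raddfB; congr (f _).
  by rewrite !opprB addrACA [in RHS]addrACA; congr (_ + _); rewrite addrC.
exists (s ++ [seq (additive_of (cB b.1), b.2) | b <- t]) => x.
(* If pi and sigma are the endomorphisms given by s and t, the new one is
   pi + sigma (1 - pi), and 1 minus it is (1 - sigma) (1 - pi). *)
rewrite big_cat big_map /= inE => /orP[/eqP->|/sP xE].
  by rewrite -tP /pi addrC subrK.
rewrite -/(pi x) -{1}[x]addr0 {1}xE; congr (_ + _).
by rewrite big1 // => b _; rewrite /pi -xE subrr raddf0 mulr0z.
Qed.

Lemma tensl_zmod_morphism (M A : zmodType) (a : A) :
  zmod_morphism (fun m : M => tens m a).
Proof.
by apply: additiveD_zmod_morphism => m m'; have [tDl _] := tens_biadditive M A.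
Qed.

Lemma tensr_zmod_morphism (M A : zmodType) (m : M) :
  zmod_morphism (@tens M A m).
Proof.
by apply: additiveD_zmod_morphism => a a'; have [_ tDr] := tens_biadditive M A.
Qed.

Lemma tensMzl (M A : zmodType) (m : M) (a : A) k :
  tens (m *~ k) a = tens m a *~ k.
Proof. exact: (raddfMz (additive_of (@tensl_zmod_morphism M A a))). Qed.

Lemma tensMzr (M A : zmodType) (m : M) (a : A) k :
  tens m (a *~ k) = tens m a *~ k.
Proof. exact: (raddfMz (additive_of (@tensr_zmod_morphism M A m))). Qed.

Lemma tens_suml (M A : zmodType) (I : Type) (s : seq I) (F : I -> M) (a : A) :
  tens (\sum_(i <- s) F i) a = \sum_(i <- s) tens (F i) a.
Proof. exact: (raddf_sum (additive_of (@tensl_zmod_morphism M A a))). Qed.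

Lemma tens_sumr (M A : zmodType) (I : Type) (s : seq I) (m : M) (F : I -> A) :
  tens m (\sum_(i <- s) F i) = \sum_(i <- s) tens m (F i).
Proof. exact: (raddf_sum (additive_of (@tensr_zmod_morphism M A m))). Qed.

Lemma tensor_sumP (M A : zmodType) (t : tensor M A) :
  exists s : seq (M * A), t = \sum_(q <- s) tens q.1 q.2.
Proof.
have [u ->] := tensor_piP t; rewrite -(freeg_sumE u) raddf_sum.
exists [seq (p.1 *~ coeff p u, p.2) | p <- dom u].
rewrite [RHS]big_map; apply: eq_bigr => -[m n] _ /=.
by rewrite tensMzl -[in LHS](intz (coeff _ _)) -freegU_mulz raddfMz.
Qed.

(** The map [phi (x) 1 : M (x) A -> Z (x) A = A] *)
Definition contract (M A : zmodType) (phi : {additive M -> int}) :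
    tensor M A -> A :=
  tensor_lift (fun m a => a *~ phi m).

Lemma contract_biadditive (M A : zmodType) (phi : {additive M -> int}) :
  biadditive (fun (m : M) (a : A) => a *~ phi m).
Proof. by split=> *; rewrite ?raddfD ?mulrzDr ?mulrzDl. Qed.

HB.instance Definition _ (M A : zmodType) (phi : {additive M -> int}) :=
  GRing.isZmodMorphism.Build (tensor M A) A (@contract M A phi)
    (tensor_lift_zmod_morphism (@contract_biadditive M A phi)).

Lemma contract_tens (M A : zmodType) (phi : {additive M -> int}) m (a : A) :
  contract phi (tens m a) = a *~ phi m.
Proof. exact/tensor_lift_tens/contract_biadditive. Qed.

Lemma contract_eq0 (M A : zmodType) (t : tensor M A) :
  locally_projective M ->
  (forall phi : {additive M -> int}, contract phi t = 0) -> t = 0.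
Proof.
move=> lpM; have [s ->] := tensor_sumP t => t0.
have [b bP] := locally_projective_seq [seq q.1 | q <- s] lpM.
transitivity (\sum_(p <- b)
  tens p.2 (contract p.1 (\sum_(q <- s) tens q.1 q.2))).
  under [RHS]eq_bigr => p _ do rewrite raddf_sum tens_sumr.
  rewrite exchange_big /=; apply: eq_big_seq => q qs.
  rewrite [in LHS](bP q.1) ?map_f // tens_suml; apply: eq_bigr => p _.
  by rewrite /= contract_tens tensMzr tensMzl.
rewrite big1 // => p _; rewrite t0.
exact: (raddf0 (additive_of (@tensr_zmod_morphism M A p.2))).
Qed.

Lemma tensor_map_zmod_morphism (M A B : zmodType) (f : {additive A -> B}) :
  zmod_morphism (@tensor_map M A B f).
Proof.
apply: tensor_lift_zmod_morphism; have [tDl tDr] := tens_biadditive M B.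
by split=> *; rewrite ?raddfD ?tDl ?tDr.
Qed.

Lemma tensor_map_sum (M A B : zmodType) (f : {additive A -> B}) (I : Type)
    (s : seq I) (F : I -> tensor M A) :
  tensor_map f (\sum_(i <- s) F i) = \sum_(i <- s) tensor_map f (F i).
Proof. exact: (raddf_sum (additive_of (@tensor_map_zmod_morphism M A B f))). Qed.

Lemma tensor_product_map_zmod_morphism (M : zmodType) (I : small)
    (N : I -> zmodType) : zmod_morphism (@tensor_product_map M I N).
Proof.
apply: tensor_lift_zmod_morphism.
by split=> *; apply: functional_extensionality_dep => j;
  have [tDl tDr] := @tens_biadditive M (N j); [apply: tDl | apply: tDr].
Qed.

Lemma tensor_product_map_sum (M : zmodType) (I : small) (N : I -> zmodType)
    (J : Type) (s : seq J) (F : J -> tensor M (product N)) :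
  tensor_product_map (\sum_(j <- s) F j)
    = \sum_(j <- s) tensor_product_map (F j).
Proof.
exact: (raddf_sum (additive_of (@tensor_product_map_zmod_morphism M I N))).
Qed.

Lemma product_sumE (I : small) (N : I -> zmodType) (J : Type) (s : seq J)
    (F : J -> product N) i : (\sum_(j <- s) F j) i = \sum_(j <- s) F j i.
Proof.
by elim: s => [|j s IHs]; rewrite ?big_nil // !big_cons -IHs.
Qed.

Lemma productMzE (I : small) (N : I -> zmodType) (x : product N) k i :
  (x *~ k) i = x i *~ k.
Proof.
have nE n : (x *+ n) i = x i *+ n.
  by elim: n => [|n IHn] //; rewrite !mulrS -IHn.
by case: k => n; rewrite ?NegzE ?mulrNz -!pmulrn -nE.
Qed.

(** A tensor killed by all the maps [contract phi] vanishes, and these maps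
    commute with monomorphisms of coefficients and with products. *)
Lemma locally_projective_flat_mittag_leffler (M : zmodType) :
  locally_projective M -> flat_mittag_leffler M.
Proof.
move=> lpM; split=> [A B f f_inj | I N].
  apply: zmod_morphism_inj; first exact: tensor_map_zmod_morphism.
  move=> t ft0; apply: contract_eq0 => // phi; apply: f_inj; rewrite raddf0.
  rewrite -(raddf0 (@contract M B phi)) -ft0.
  have [s ->] := tensor_sumP t.
  rewrite tensor_map_sum !raddf_sum; apply: eq_bigr => q _.
  by rewrite /= contract_tens raddfMz /= tensor_map_tens contract_tens.
apply: zmod_morphism_inj; first exact: tensor_product_map_zmod_morphism.
move=> t ft0; apply: contract_eq0 => // phi.
apply: functional_extensionality_dep => i.
transitivity (contract phi (tensor_product_map t i)); last first.
  by rewrite ft0; apply: raddf0.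
have [s ->] := tensor_sumP t.
rewrite tensor_product_map_sum raddf_sum !product_sumE raddf_sum.
apply: eq_bigr => q _.
by rewrite /= contract_tens tensor_product_map_tens contract_tens productMzE.
Qed.

Lemma locally_projective_iso (M M' : zmodType) (f : {additive M -> M'})
    (g : {additive M' -> M}) :
  cancel g f -> locally_projective M -> locally_projective M'.
Proof.
move=> gK lpM x; have [s sP] := lpM (g x).
exists [seq ([the {additive M' -> int} of b.1 \o g], f b.2)
        | b : {additive M -> int} * M <- s].
rewrite -{1}[x]gK sP big_map raddf_sum.
by apply: eq_bigr => b _; rewrite raddfMz.
Qed.

(** The hypotheses say that the maps [ev k] embed [M] as a pure subgroup of a
    power of Z. *)
Lemma pure_in_power_locally_projective (M : zmodType) (K : Type)
    (ev : K -> {additive M -> int}) :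
  (forall x, (forall k, ev k x = 0) -> x = 0) ->
  (forall x (d : int), d != 0 -> (forall k, (d %| ev k x)%Z) ->
     exists y, x = y *~ d) ->
  locally_projective M.
Proof.
move=> ev_inj ev_pure x.
have [x0|] := pselect (forall k, ev k x = 0).
  by exists [::]; rewrite big_nil; exact: ev_inj.
case/existsNP=> k /eqP kx.
pose P n :=
  `[< exists phi : {additive M -> int}, phi x != 0 /\ `|phi x|%N = n >].
have exP : exists n, P n by exists `|ev k x|%N; apply/asboolP; exists (ev k).
(* A smallest nonzero value generates the ideal of the values at x. *)
case: (ex_minnP exP) => _ /asboolP[phi [phix <-]] phi_min.
have [|y xE] := ev_pure x (phi x) phix; last first.
  by exists [:: (phi, y)]; rewrite big_seq1.
move=> j; set q := (ev j x %/ phi x)%Z.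
have rB : zmod_morphism (fun y => ev j y - q * phi y).
  by move=> u v; rewrite !raddfB /=; ring.
apply/dvdz_mod0P; apply: contrapT => /eqP r0.
have rE : additive_of rB x = (ev j x %% phi x)%Z by [].
have /phi_min : P `|(ev j x %% phi x)%Z|%N.
  by apply/asboolP; exists (additive_of rB); rewrite rE.
rewrite leqNgt => /negP; apply.
by rewrite -ltz_nat !abszE ger0_norm ?modz_ge0 // ltz_mod.
Qed.

(** * Flat Mittag-Leffler groups have no 2-divisible part *)

Lemma pow2_residues_inj :
  injective (fun m : int => (fun n => 1 *~ m) :
    product (fun n : nat => 'Z_(2 ^ n.+1) : zmodType)).
Proof.
apply: zmod_morphism_inj => [m m'|m m0].
  by apply: functional_extensionality_dep => n; rewrite mulrzBr.
pose k := `|m|%N.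
have k0 : (k%:R : 'Z_(2 ^ k.+1)) = 0.
  have := congr1 (fun x : product _ => x k) m0; rewrite /= -[m]intz pmulrn.
  by rewrite [m]intEsign -/k; case: (m < 0) => //=; rewrite ?mulN1r ?mul1r
    ?mulrNz ?intz // => /eqP; rewrite oppr_eq0 => /eqP.
have k_lt : (k < 2 ^ k.+1)%N by rewrite (ltn_trans (ltnSn k)) // ltn_expl.
have pow2_gt1 : (1 < 2 ^ k.+1)%N by rewrite (leq_trans _ (ltn_expl k.+1 _)).
have := congr1 val k0; rewrite /= val_Zp_nat // modn_small // => /eqP.
by rewrite absz_eq0 => /eqP.
Qed.

Lemma flat_mittag_leffler_reduced (B : zmodType) (b : B) :
  flat_mittag_leffler B -> (forall n, exists c, b = c *+ 2 ^ n) -> b = 0.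
Proof.
case=> flatB mlB b_div.
pose N (n : nat) : zmodType := 'Z_(2 ^ n.+1).
pose r (m : int) : product N := fun n => 1 *~ m.
have rB : zmod_morphism r.
  by move=> m m'; apply: functional_extensionality_dep => n; apply: mulrzBr.
have /flatB r_inj : injective (additive_of rB) by exact: pow2_residues_inj.
have mulb_bi : biadditive (fun (m : B) (k : int) => m *~ k).
  by split=> *; rewrite ?mulrzDr ?mulrzDl.
suff b1 : tens b (1 : int) = 0.
  rewrite -[b]mulr1z -(tensor_lift_tens _ _ mulb_bi) b1.
  exact: (raddf0 (additive_of (tensor_lift_zmod_morphism mulb_bi))).
apply: r_inj; rewrite tensor_map_tens.
have -> : tensor_map (additive_of rB) (0 : tensor B int) = 0.
  exact: (raddf0 (additive_of
    (@tensor_map_zmod_morphism B _ _ (additive_of rB)))).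
apply: mlB.
apply: functional_extensionality_dep => n.
have [c bE] := b_div n.+1.
rewrite tensor_product_map_tens.
have -> : tensor_product_map (0 : tensor B (product N)) = 0.
  exact: (raddf0 (additive_of (@tensor_product_map_zmod_morphism B nat N))).
have -> : additive_of rB 1 n = 1 by exact: mulr1z.
rewrite bE pmulrn tensMzl -tensMzr -pmulrn pchar_Zp.
  exact: (raddf0 (additive_of (@tensr_zmod_morphism B (N n) c))).
by rewrite (leq_trans _ (ltn_expl n.+1 _)).
Qed.

(** * The group of a tree *)

Lemma eventually_seq (T : eqType) (P : T -> nat -> Prop) (s : seq T) :
  (forall x, x \in s -> exists N, forall n, (N <= n)%N -> P x n) ->
  exists N, forall x, x \in s -> forall n, (N <= n)%N -> P x n.
Proof.
elim: s => [|x s IHs] sP; first by exists 0%N.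
have [N NP] := sP _ (mem_head x s).
have [y ys|N' N'P] := IHs; first by apply: sP; rewrite inE ys orbT.
exists (maxn N N') => y; rewrite inE => /orP[/eqP->|ys] n; rewrite geq_max.
  by case/andP=> /NP.
by case/andP=> _; apply: N'P.
Qed.

Section TreeGroup.
(* A node of level n is on the branch x when it is equal to node n x; two distinct
   branches share no node of large level. *)
Variables (I X : choiceType) (lev : I -> nat) (node : nat -> X -> I).
Hypothesis lev_node : forall n x, lev (node n x) = n.
Hypothesis node_sep : forall x y, x <> y ->
  exists N, forall n, (N <= n)%N -> node n x <> node n y.

Notation weights := {freeg X / rat}.
Notation values := (product (fun _ : I => int)).

(** The total weight of the branches through the node [i] *)
Definition node_weight (i : I) (w : weights) : rat :=
  fglift (fun x => (node (lev i) x == i)%:R : rat^o) w.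

HB.instance Definition _ i :=
  GRing.isZmodMorphism.Build weights rat (node_weight i)
    (@freeg.lift_is_additive _ _ (rat^o : lmodType rat) _).

Lemma node_weightE i w : node_weight i w =
  \sum_(x <- dom w) coeff x w * (node (lev i) x == i)%:R.
Proof.
rewrite -{1}(freeg_sumE w) raddf_sum; apply: eq_bigr => x _ /=.
by rewrite /node_weight liftU.
Qed.

Lemma node_weight_eventually w x :
  exists N, forall n, (N <= n)%N -> node_weight (node n x) w = coeff x w.
Proof.
have [y _|N NP] := @eventually_seq X
    (fun y n => (node n y == node n x) = (y == x)) (dom w).
  have [->|yx] := eqVneq y x; first by exists 0%N => n _; rewrite eqxx.
  have [|N NP] := @node_sep y x; first exact/eqP.
  by exists N => n /NP yxn; apply/eqP.
exists N => n Nn; rewrite node_weightE lev_node -[in RHS](freeg_sumE w).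
rewrite raddf_sum; apply: eq_big_seq => y yw /=.
by rewrite coeffU NP.
Qed.

Lemma node_notin (J : seq I) x :
  exists N, forall n, (N <= n)%N -> node n x \notin J.
Proof.
have [i _|N NP] := @eventually_seq I (fun i n => node n x != i) J.
  exists (lev i).+1 => n; apply: contraTneq => <-.
  by rewrite lev_node ltnn.
by exists N => n Nn; apply/negP => /NP/(_ n Nn); rewrite eqxx.
Qed.

Definition tree_pred : {pred weights * values} := fun e =>
  `[< exists J : seq I, forall i, i \notin J ->
        (e.2 i)%:~R = 2 ^+ lev i * node_weight i e.1 >].

Lemma tree_pred_zmod_closed : zmod_closed tree_pred.
Proof.
split.
  apply/asboolP; exists [::] => i _; transitivity (0 : rat); first by [].
  by rewrite -(mulr0 (2 ^+ lev i)); congr (_ * _); rewrite raddf0.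
move=> e e' /asboolP[J JP] /asboolP[J' J'P]; apply/asboolP.
exists (J ++ J') => i; rewrite mem_cat negb_or => /andP[iJ iJ'].
transitivity ((e.2 i - e'.2 i)%:~R : rat); first by [].
by rewrite rmorphB /= JP // J'P // -mulrBr -raddfB.
Qed.

HB.instance Definition _ :=
  GRing.isZmodClosed.Build (weights * values)%type tree_pred
    tree_pred_zmod_closed.

(** The pairs [(w, f)] where [w] is a finitely supported rational weight on the
    branches and [f] is an integral function on the nodes which, off a finite
    set, is the sum over the branches [x] of [w x] times the function with
    value [2 ^ n] at the node of level [n] of [x].  The first component is
    determined by the second one. *)
Record tree_group := TreeGroup {
  tree_val :> weights * values;
  tree_valP : tree_val \in tree_pred
}.

HB.instance Definition _ := [isSub for tree_val].
HB.instance Definition _ := [Choice of tree_group by <:].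
HB.instance Definition _ := [SubChoice_isSubZmodule of tree_group by <:].

Lemma tree_valB (e e' : tree_group) :
  tree_val (e - e') = tree_val e - tree_val e'.
Proof. exact: (raddfB (val : tree_group -> weights * values)). Qed.

Definition tree_weights (e : tree_group) : weights := (tree_val e).1.
Definition tree_ev (i : I) (e : tree_group) : int := (tree_val e).2 i.

Lemma tree_weights_zmod_morphism : zmod_morphism tree_weights.
Proof. by move=> e e'; rewrite /tree_weights tree_valB. Qed.

Lemma tree_ev_zmod_morphism i : zmod_morphism (tree_ev i).
Proof. by move=> e e'; rewrite /tree_ev tree_valB. Qed.

HB.instance Definition _ :=
  GRing.isZmodMorphism.Build tree_group weights tree_weights
    tree_weights_zmod_morphism.
HB.instance Definition _ i :=
  GRing.isZmodMorphism.Build tree_group int (tree_ev i)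
    (tree_ev_zmod_morphism i).

Lemma tree_ext (e e' : tree_group) :
  tree_weights e = tree_weights e' -> (forall i, tree_ev i e = tree_ev i e') ->
  e = e'.
Proof.
rewrite /tree_weights /tree_ev => e1 e2; apply: val_inj => /=.
rewrite [tree_val e]surjective_pairing [tree_val e']surjective_pairing e1.
by congr (_, _); apply: functional_extensionality_dep.
Qed.

Lemma tree_groupP (e : tree_group) : exists J : seq I, forall i, i \notin J ->
  (tree_ev i e)%:~R = 2 ^+ lev i * node_weight i (tree_weights e).
Proof. exact/asboolP/tree_valP. Qed.

Lemma tree_eventually (e : tree_group) x : exists N, forall n, (N <= n)%N ->
  (tree_ev (node n x) e)%:~R = 2 ^+ n * coeff x (tree_weights e).
Proof.
have [J JP] := tree_groupP e.
have [N NP] := node_weight_eventually (tree_weights e) x.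
have [N' N'P] := node_notin J x.
exists (maxn N N') => n; rewrite geq_max => /andP[/NP <- /N'P nJ].
by rewrite JP // lev_node.
Qed.

Lemma tree_group_locally_projective : locally_projective tree_group.
Proof.
apply: (@pure_in_power_locally_projective tree_group I (fun i => tree_ev i)).
  move=> e e0; apply: tree_ext => [|i]; last by rewrite raddf0 e0.
  rewrite raddf0; apply/eqP/freeg_eqP => x; rewrite [RHS]coeff0.
  have [N /(_ N (leqnn N))] := tree_eventually e x.
  rewrite e0 => /esym/eqP.
  by rewrite mulf_eq0 expf_eq0 pnatr_eq0 andbF => /eqP.
move=> e d d0 d_dvd.
have dQ0 : (d%:~R : rat) != 0 by rewrite intr_eq0.
pose w : weights := (d%:~R)^-1 *: tree_weights e.
pose f : values := fun i => (tree_ev i e %/ d)%Z.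
have wE : tree_weights e = w *~ d.
  by rewrite -scaler_int scalerA divff // scale1r.
have fE i : tree_ev i e = f i * d by exact: esym (divzK (d_dvd i)).
have wfP : (w, f) \in tree_pred.
  have [J JP] := tree_groupP e; apply/asboolP; exists J => i /JP /=.
  rewrite wE fE raddfMz /= intrM -(mulrzr (node_weight _ _)) mulrA.
  exact: mulIf.
exists (TreeGroup wfP); apply: tree_ext => [|i]; rewrite raddfMz //=.
by rewrite fE mulrzz.
Qed.

(** Almost all nodes where the value is nonzero are far along a branch, and there
    the value is twice the value at the preceding node. *)
Lemma tree_almost_even (e : tree_group) :
  exists J : seq I, forall i, i \notin J -> (2 %| tree_ev i e)%Z.
Proof.
have [J JP] := tree_groupP e; set w := tree_weights e in JP.
have [x _|N NP] := @eventually_seq X (fun x n =>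
    (tree_ev (node n x) e)%:~R = 2 ^+ n * coeff x w) (dom w).
  exact: tree_eventually.
exists (J ++ [seq node n x | x <- dom w, n <- iota 0 N.+1]) => i.
(* Off this finite set, a node is off all branches of nonzero weight or far
   enough along one of them. *)
rewrite mem_cat negb_or => /andP[iJ /negP inode].
have [w0|] := eqVneq (node_weight i w) 0.
  have /eqP := JP i iJ; rewrite w0 mulr0 intr_eq0 => /eqP ->.
  exact: dvdz0.
rewrite node_weightE => wi.
have [x xw xi] : exists2 x, x \in dom w & node (lev i) x = i.
  apply: contrapT => noxi; case/eqP: wi; rewrite big_seq big1 // => x xw.
  by case: eqP => [xi|]; rewrite ?mulr0 //; case: noxi; exists x.
have levi : (N < lev i)%N.
  rewrite ltnNge; apply/negP => iN; apply: inode; apply/allpairsPdep.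
  by exists x, (lev i); rewrite mem_iota.
case: (lev i) levi xi => // n nN <-.
apply/dvdzP; exists (tree_ev (node n x) e).
apply: (@intr_inj rat); rewrite intrM !NP ?(ltnW nN) //.
by rewrite exprSr mulrAC.
Qed.

Definition delta_val (i : I) : values := fun j => (j == i)%:Z.

Lemma delta_pred (i : I) : ((0 : weights), delta_val i) \in tree_pred.
Proof.
apply/asboolP; exists [:: i] => j; rewrite inE /= /delta_val => /negPf ->.
by rewrite (raddf0 (node_weight j)) mulr0.
Qed.

(** The characteristic function of the node [i] *)
Definition tree_delta (i : I) : tree_group := TreeGroup (delta_pred i).

Definition line_val (x : X) : values :=
  fun i => (node (lev i) x == i)%:Z * 2 ^+ lev i.

Lemma line_pred (x : X) : (<< x >> : weights, line_val x) \in tree_pred.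
Proof.
apply/asboolP; exists [::] => i _ /=.
rewrite /line_val /node_weight liftU scale1r mulrC intrM.
by rewrite rmorphXn.
Qed.

(** The function with value [2 ^ n] at the node of level [n] of [x], for all
    [n], and zero elsewhere *)
Definition tree_line (x : X) : tree_group := TreeGroup (line_pred x).

(** The homomorphism to Q that maps [tree_line x] to [c x] and vanishes on the
    functions of finite support *)
Definition weight_sum (c : X -> rat) (e : tree_group) : rat :=
  fglift (c : X -> rat^o) (tree_weights e).

Lemma weight_sum_zmod_morphism c : zmod_morphism (weight_sum c).
Proof.
move=> e e'; rewrite /weight_sum raddfB.
exact: (@freeg.lift_is_additive _ _ (rat^o : lmodType rat) c).
Qed.

HB.instance Definition _ c :=
  GRing.isZmodMorphism.Build tree_group rat (weight_sum c)
    (weight_sum_zmod_morphism c).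

Lemma weight_sum_line c x : weight_sum c (tree_line x) = c x.
Proof. by rewrite /weight_sum liftU scale1r. Qed.

(** The functions of finite support are spanned by the [tree_delta i]. *)
Lemma tree_delta_span (B : zmodType) (h : {additive tree_group -> B}) :
  (forall i, h (tree_delta i) = 0) ->
  forall (J : seq I) e, tree_weights e = 0 ->
    (forall i, i \notin J -> tree_ev i e = 0) -> h e = 0.
Proof.
move=> h0; elim=> [|j J IHJ] e e1 e2.
  suff -> : e = 0 by exact: raddf0.
  by apply: tree_ext => [|i]; rewrite raddf0 ?e2.
have dE i : tree_ev i (tree_delta j) = (i == j)%:Z by [].
have /IHJ he : tree_weights (e - tree_delta j *~ tree_ev j e) = 0.
  by rewrite raddfB raddfMz /= e1 mul0rz subr0.
rewrite -[e](subrK (tree_delta j *~ tree_ev j e)) raddfD.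
rewrite (raddfMz h) h0 mul0rz addr0.
apply: he => i iJ; rewrite raddfB raddfMz /= dE.
have [->|ij] := eqVneq i j; first by rewrite intz subrr.
by rewrite mul0rz subr0 e2 // inE negb_or ij.
Qed.

(** The quotient of the tree group by the span of the [tree_delta i] is
    2-divisible, so it has no nonzero homomorphism to [B]. *)
Lemma tree_hom_eq0 (B : zmodType) (h : {additive tree_group -> B}) :
  flat_mittag_leffler B -> (forall i, h (tree_delta i) = 0) ->
  forall e, h e = 0.
Proof.
move=> fmlB h0.
have half e : exists e', h e = h e' *+ 2.
  have [J Jeven] := tree_almost_even e.
  (* Let e' have half the weights of e and the rounded halves of its values:
     then e - 2 e' has weights zero and finite support. *)
  pose w : weights := 2^-1 *: tree_weights e.
  pose f : values := fun i => (tree_ev i e %/ 2)%Z.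
  have wE : tree_weights e = w *+ 2.
    by rewrite -scaler_nat scalerA divff ?scale1r ?pnatr_eq0.
  have wfP : (w, f) \in tree_pred.
    have [J' J'P] := tree_groupP e; apply/asboolP; exists (J ++ J') => i.
    rewrite mem_cat negb_or => /andP[/Jeven i2 /J'P] /=.
    have -> : tree_ev i e = f i * 2 by exact: esym (divzK i2).
    rewrite wE raddfMn /= intrM -(mulr_natr (node_weight _ _)) mulrA.
    by apply: mulIf; rewrite pnatr_eq0.
  exists (TreeGroup wfP); apply/eqP; rewrite -subr_eq0 -raddfMn -raddfB /=.
  apply/eqP/(tree_delta_span h0 (J := J)).
    by rewrite raddfB raddfMn /= wE subrr.
  move=> i /Jeven i2; rewrite raddfB raddfMn /= -[in X in X - _](divzK i2).
  by rewrite mulr_natr subrr.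
move=> e; apply: flat_mittag_leffler_reduced => // n.
suff [e' ->] : exists e', h e = h e' *+ 2 ^ n by exists (h e').
elim: n => [|n [e' ->]]; first by exists e.
by have [e'' ->] := half e'; exists e''; rewrite -mulrnA expnS.
Qed.

End TreeGroup.

(** * Rational homomorphisms that do not factor *)

Lemma no_injection_powerset (T : Type) (r : (T -> bool) -> T) : ~ injective r.
Proof.
move=> r_inj.
pose d x := `[< exists2 c, r c = x & ~~ c x >].
have [dr|ndr] := boolP (d (r d)).
  have /asboolP[c /r_inj ->] := dr.
  by rewrite dr.
by have /asboolP := ndr; apply; exists d.
Qed.

(** The nodes of level [n] of the tree.  A branch [x] chooses for each [n] a map
    [x n] from the nodes of level [n] to [B], and its node of level [n] records
    [x 0], ..., [x n.-1].  Thus a branch is also a map from all nodes to [B]. *)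
Fixpoint history (B : Type) (n : nat) : Type :=
  if n is n'.+1 then (history B n' * (history B n' -> B))%type else unit.

Definition branch (B : Type) := forall n, history B n -> B.

(** The node of level [n] of the branch [x] *)
Fixpoint truncate (B : Type) (x : branch B) n : history B n :=
  if n is n'.+1 then (truncate x n', x n') else tt.

(** The set of all nodes *)
Definition history_node (B : Type) := {classic {n & history B n}}.

Definition node_of (B : Type) n (x : {classic branch B}) : history_node B :=
  existT (history B) n (truncate x n).

Definition level (B : Type) (i : history_node B) : nat := projT1 i.

Lemma level_node_of (B : Type) n (x : {classic branch B}) :
  level (node_of n x) = n.
Proof. by []. Qed.

Lemma truncate_inj (B : Type) (x y : branch B) n :
  truncate x n = truncate y n -> forall m, (m < n)%N -> x m = y m.
Proof.
elim: n => //= n IHn [xy_n xy] m; rewrite ltnS leq_eqVlt => /orP[/eqP->|] //.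
exact: IHn.
Qed.

Lemma node_of_sep (B : Type) (x y : {classic branch B}) : x <> y ->
  exists N, forall n, (N <= n)%N -> node_of n x <> node_of n y.
Proof.
move=> xy; have [m xym] : exists m, x m <> y m.
  apply/existsNP => xym; apply: xy.
  by apply: functional_extensionality_dep.
exists m.+1 => n mn exy; apply: xym.
have : truncate x n = truncate y n by exact: existT_inj2 exy.
by move=> /truncate_inj; apply.
Qed.

Lemma locally_projective_nonfactoring (B : zmodType)
    (phi : {additive B -> rat}) :
  flat_mittag_leffler B ->
  exists (E : zmodType) (g : {additive E -> rat}), locally_projective E /\
    ~ exists h : {additive E -> B}, forall e, phi (h e) = g e.
Proof.
move=> fmlB; pose E : zmodType := tree_group (@level B) (@node_of B).
apply: contrapT => factors.
have lift (c : {classic branch B} -> bool) : {h : {additive E -> B} |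
    forall e, phi (h e) = weight_sum (fun x => (c x)%:R) e}.
  apply: cid; apply: contrapT => noh; apply: factors.
  exists E, (weight_sum (fun x => (c x)%:R)); split=> //.
  exact: tree_group_locally_projective (@level_node_of B) (@node_of_sep B).
(* The restriction of a lift of c to the basis of the functions of finite
   support, read as a branch *)
pose r (c : branch B -> bool) : branch B :=
  fun n t => sval (lift c) (tree_delta (@level B) (@node_of B) (existT _ n t)).
apply: (@no_injection_powerset _ r) => c c' rcc'.
have hcc' : forall e, sval (lift c) e = sval (lift c') e.
  move=> e; apply/eqP; rewrite -subr_eq0; apply/eqP.
  apply: (@tree_hom_eq0 _ _ _ _ (@level_node_of B) (@node_of_sep B) B
    [the {additive E -> B} of sval (lift c) \- sval (lift c')]) => // -[n t].
  rewrite /= -/(r c n t) -/(r c' n t) rcc'; exact: subrr.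
apply: functional_extensionality_dep => x.
have := congr1 phi (hcc' (tree_line (@level B) (@node_of B) x)).
rewrite (svalP (lift c)) (svalP (lift c')) !weight_sum_line => /eqP.
by rewrite eqr_nat; case: (c x) (c' x) => [] [].
Qed.

(** * Model structures *)

(** The precover of [M] is obtained by factoring the map from the initial object
    as a cofibration followed by a trivial fibration, or as a trivial
    cofibration followed by a fibration; it is a precover by lifting. *)
Lemma model_precover (C : category) (m : model_data C) (D : C -> Prop) (Z : C) :
  is_model_structure m -> induced_by m D -> initial Z ->
  precovering D.
Proof.
move=> mP indD initZ M; have [z _] := initZ M.
have initial_eq (Z' Y : C) (f g : hom Z' Y) : initial Z' -> f = g.
  by move=> /(_ Y)[k [_ k_uniq]]; rewrite -(k_uniq f) // -(k_uniq g).
case: indD => DE.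
  have [X [i [p [cofi tfibp _]]]] := cof_factors mP z.
  exists X, p; split=> [|X' /DE[Z' [j [initZ' cofj]]] f].
    by apply/DE; exists Z, i.
  have [u _] := initZ' X.
  have [|h [_ hP]] := cof_lifts mP cofj tfibp (u := u) (v := f).
    exact: initial_eq.
  by exists h.
have [X [i [p [cofi fibp _]]]] := trivial_cof_factors mP z.
exists X, p; split=> [|X' /DE[Z' [j [initZ' cofj]]] f].
  by apply/DE; exists Z, i.
have [u _] := initZ' X.
have [|h [_ hP]] := trivial_cof_lifts mP cofj fibp (u := u) (v := f).
  exact: initial_eq.
by exists h.
Qed.

Section Equivalence.
Variables (C : category) (G : functor C Ab).
Hypothesis eqG : is_equivalence G.

Lemma equivalence_full (X Y : C) (g : hom (G X) (G Y)) :
  exists f : hom X Y, fmap G f = g.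
Proof. by have [k kK Kk] := fully_faithful eqG X Y; exists (k g). Qed.

Lemma equivalence_has_initial : exists Z : C, initial Z.
Proof.
pose O : zmodType := product (fun _ : void => int : zmodType).
have O_eq (x y : O) : x = y by apply: functional_extensionality_dep => -[].
have [Z [f [g [gf _]]]] := essentially_surjective eqG (O : Ab).
exists Z => Y.
have GZ0 (x : G Z) : x = 0.
  have <- : g (f x) = x.
    by exact: (congr1 (fun k : {additive _ -> _} => k x) gf).
  by rewrite (O_eq (f x) 0) raddf0.
have [z _] := @equivalence_full Z Y [the {additive G Z -> G Y} of \0].
exists z; split=> // z' _; apply: (bij_inj (fully_faithful eqG Z Y)).
by apply: additive_eq => x; rewrite (GZ0 x) !raddf0.
Qed.

Lemma equivalence_no_precover :
  ~ precovering (fun X : C => flat_mittag_leffler (G X)).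
Proof.
move=> prec; have [M [u [v [vu uv]]]] := essentially_surjective eqG (rat : Ab).
have [X [p [fmlX pP]]] := prec M.
have [E [g [lpE nofactor]]] :=
  locally_projective_nonfactoring [the {additive _ -> _} of u \o fmap G p] fmlX.
have [X' [s [t [ts st]]]] := essentially_surjective eqG (E : Ab).
have stK : cancel s t.
  by move=> x; exact: (congr1 (fun k : {additive _ -> _} => k x) ts).
have tsK : cancel t s.
  by move=> x; exact: (congr1 (fun k : {additive _ -> _} => k x) st).
have uvK : cancel v u.
  by move=> x; exact: (congr1 (fun k : {additive _ -> _} => k x) uv).
have [f fE] := @equivalence_full X' M [the {additive _ -> _} of v \o g \o s].
have [|h hP] := pP X' _ f.
  apply: locally_projective_flat_mittag_leffler.
  exact: (locally_projective_iso stK lpE).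
apply: nofactor; exists [the {additive _ -> _} of fmap G h \o t] => e /=.
have <- : fmap G f (t e) = fmap G p (fmap G h (t e)).
  by rewrite -hP fmapM.
by rewrite fE /= uvK tsK.
Qed.

End Equivalence.

Theorem theorem1p5 :
  ~ precovering (C := Ab) flat_mittag_leffler /\
  forall (QcoZ : category) (sections : functor QcoZ Ab),
    is_equivalence sections ->
    ~ exists m : model_data QcoZ,
        [/\ is_model_structure m, cofibrantly_generated m, abelian_compatible m
          & induced_by m (fun X => flat_mittag_leffler (sections X))].
Proof.
split=> [prec | QcoZ sections eqS [m [mP _ _ indm]]].
  have [B [phi [fmlB phiP]]] := prec (rat : Ab).
  have [E [g [lpE]]] := locally_projective_nonfactoring phi fmlB; apply.
  have [h hP] := phiP (E : Ab) (locally_projective_flat_mittag_leffler lpE) g.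
  by exists h => e; rewrite -hP.
have [Z initZ] := equivalence_has_initial eqS.
by apply: (equivalence_no_precover eqS); apply: model_precover mP indm initZ.
Qed.
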